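(* Let $Y$ be a finite connected simple undirected graph on $n$ vertices and $e=\{v,w\}$ a cycle-edge of $Y$. Let $Y'$ be $Y$ with $e$ deleted and $Y''$ be $Y$ with $e$ contracted. Define $\Theta\colon\mathsf{Acyc}(Y)/\!\sim_\kappa\to\big(\mathsf{Acyc}(Y')/\!\sim_\kappa\big)\sqcup\big(\mathsf{Acyc}(Y'')/\!\sim_\kappa\big)$ as follows: if the class $[O_Y]$ contains an orientation $O^\pi_Y$ with $\pi=(v,w,\pi_3,\dots,\pi_n)$, then $\Theta([O_Y])$ is the $\kappa$-class in $Y''$ of the induced orientation $O^\pi_{Y''}$; otherwise $\Theta([O_Y])$ is the $\kappa$-class in $Y'$ of the restriction $O_{Y'}$ of any element $O_Y$ of the class. Then $\Theta$ is a bijection.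
   Context: A cycle-edge is an edge whose removal does not disconnect its component. $Y''$ is the simple graph obtained by identifying $v$ and $w$ into one vertex, removing $e$ and identifying parallel edges. $\mathsf{Acyc}(Z)$ denotes the set of acyclic orientations of a graph $Z$. For a permutation $\pi=(\pi_1,\dots,\pi_n)$ of the vertices, $O^\pi_Y$ is the acyclic orientation with each edge $\{i,j\}$ directed $(i,j)$ iff $i$ precedes $j$ in $\pi$; when $\pi$ starts with $v,w$, $O^\pi_{Y''}$ is the induced acyclic orientation of $Y''$ (edges keep their orientation). A click at a vertex $x$ which is a source reverses all edges incident to $x$; two acyclic orientations of a graph are $\kappa$-equivalent if one can be transformed into the other by a finite sequence of clicks, and $\mathsf{Acyc}(Z)/\!\sim_\kappa$ is the set of $\kappa$-classes. *)

(* Defs.v *)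
From Stdlib Require Import Relations ClassicalEpsilon.
From HB Require Import structures.
From mathcomp Require Import all_boot.



Unset Printing Implicit Defensive.

Section Orientations.
Variable V : finType.

Definition arcs (o : {set V * V}) : rel V := fun x y => (x, y) \in o.

Definition is_orientation (E : rel V) (o : {set V * V}) : bool :=
  [forall x, forall y,
     (((x, y) \in o) ==> E x y) &&
     (E x y ==> (((x, y) \in o) != ((y, x) \in o)))].

Definition acyclic_orientation (E : rel V) (o : {set V * V}) : bool :=
  is_orientation E o &&
  [forall x, forall y, ((x, y) \in o) ==> ~~ connect (arcs o) y x].

Definition is_source (E : rel V) (o : {set V * V}) (x : V) : bool :=
  [forall y, E x y ==> ((x, y) \in o)].

Definition click (o : {set V * V}) (x : V) : {set V * V} :=
  [set p | if (p.1 == x) || (p.2 == x) then (p.2, p.1) \in o else p \in o].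

Definition click_step (E : rel V) (o1 o2 : {set V * V}) : Prop :=
  exists x, is_source E o1 x /\ o2 = click o1 x.

Definition kappa_equiv (E : rel V) : relation {set V * V} :=
  clos_refl_sym_trans _ (click_step E).

Definition rank_orient (E : rel V) (r : V -> nat) : {set V * V} :=
  [set p | E p.1 p.2 && (r p.1 < r p.2)].

Definition simple_graph (E : rel V) : Prop := symmetric E /\ irreflexive E.
Definition connected_graph (E : rel V) : Prop := forall x y, connect E x y.

End Orientations.
Arguments arcs {V}. Arguments is_orientation {V}. Arguments acyclic_orientation {V}.
Arguments is_source {V}. Arguments click {V}. Arguments click_step {V}.
Arguments kappa_equiv {V}. Arguments rank_orient {V}. Arguments simple_graph {V}.
Arguments connected_graph {V}.

Section Minors.
Variable T : finType.

Definition del_edge (E : rel T) (v w : T) : rel T :=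
  fun x y => E x y && ~~ (((x == v) && (y == w)) || ((x == w) && (y == v))).

Definition cycle_edge (E : rel T) (v w : T) : Prop :=
  E v w /\ forall x y, connect E x y -> connect (del_edge E v w) x y.

(* Y'' : vertex set T \ {w}; w is identified with v *)
Definition merge (v w a : T) : T := if a == w then v else a.

Definition contr_edge (E : rel T) (v w : T) : rel {x : T | x != w} :=
  fun x y => (val x != val y) &&
    [exists a, exists b, [&& E a b, merge v w a == val x & merge v w b == val y]].

Definition starts_vw (v w : T) (pi : seq T) : bool :=
  perm_eq pi (enum T) && (take 2 pi == [:: v; w]).

Definition O_pi (E : rel T) (pi : seq T) : {set T * T} :=
  rank_orient E (fun x => index x pi).

(* induced orientation of Y'' (edges keep their orientation) *)
Definition O_pi_contr (E : rel T) (v w : T) (pi : seq T)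
  : {set {x : T | x != w} * {x : T | x != w}} :=
  rank_orient (contr_edge E v w) (fun x => index (val x) pi).

Definition restrict_del (E : rel T) (v w : T) (o : {set T * T}) : {set T * T} :=
  [set p in o | del_edge E v w p.1 p.2].

Definition Theta (E : rel T) (v w : T) (O : {set T * T})
  : {set T * T} + {set {x : T | x != w} * {x : T | x != w}} :=
  match excluded_middle_informative
          (exists pi, starts_vw v w pi /\ kappa_equiv E O (O_pi E pi)) with
  | left H => inr (O_pi_contr E v w
                     (proj1_sig (constructive_indefinite_description _ H)))
  | right _ => inl (restrict_del E v w O)
  end.

Definition kappa_sum (E : rel T) (v w : T)
  (X Z : {set T * T} + {set {x : T | x != w} * {x : T | x != w}}) : Prop :=
  match X, Z with
  | inl a, inl b => kappa_equiv (del_edge E v w) a b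
  | inr a, inr b => kappa_equiv (contr_edge E v w) a b
  | _, _ => False
  end.

Definition acyc_sum (E : rel T) (v w : T)
  (X : {set T * T} + {set {x : T | x != w} * {x : T | x != w}}) : Prop :=
  match X with
  | inl a => acyclic_orientation (del_edge E v w) a
  | inr a => acyclic_orientation (contr_edge E v w) a
  end.

End Minors.
Arguments del_edge {T}. Arguments cycle_edge {T}. Arguments merge {T}.
Arguments contr_edge {T}. Arguments starts_vw {T}. Arguments O_pi {T}.
Arguments O_pi_contr {T}. Arguments restrict_del {T}. Arguments Theta {T}.
Arguments kappa_sum {T}. Arguments acyc_sum {T}.

(* Main.v *)
(** Two acyclic orientations are kappa-equivalent iff they differ by a potential, a
    function [f] (the number of clicks at each vertex) with
    [O1(x,y) + f y = O2(x,y) + f x] on every edge (Pretzel). Between two orientations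
    in which [v] precedes [w], a potential for [Y] is a potential for [Y'] with
    [f v = f w]. If both orientations come from permutations starting with [v, w],
    such potentials are exactly those of [Y'']. Otherwise both classes have a
    representative with source [v] and a directed path from [v] to [w] in [Y'], and as
    potentials are monotone along directed paths, [f v = f w] is automatic for
    every potential of [Y']. Conversely, since [Y'] is connected, every class of [Y'] has
    a member in which [v] reaches [w], and adding the arc [(v,w)] to it gives the
    preimage. *)
Require Import Defs.
From Stdlib Require Import Relations ClassicalEpsilon.
From HB Require Import structures.
From mathcomp Require Import all_boot zify.

Set Implicit Arguments.
Unset Strict Implicit.

(* [path.merge] shadows the vertex identification of [Defs]. *)
Local Notation merge := Defs.merge.

(* [lia] fails on membership atoms unless they are generalized first. *)
Ltac mem_lia :=
  repeat match goal with |- context [?x \in ?A] => move: (x \in A) => ? end; lia.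

(** * Orientations from ranks, and potentials between them *)

Section Potential.
Variable V : finType.
Implicit Types (E : rel V) (o : {set V * V}) (r f : V -> nat).

Definition potential E o1 o2 f :=
  forall x y, E x y -> ((x, y) \in o1) + f y = ((x, y) \in o2) + f x.

Definition proper_rank E r := forall x y, E x y -> r x != r y.

Lemma in_rank_orient E r x y :
  ((x, y) \in rank_orient E r) = E x y && (r x < r y).
Proof. by rewrite inE. Qed.

Lemma orientation_sub E o x y :
  is_orientation E o -> (x, y) \in o -> E x y.
Proof. by move=> /forallP/(_ x)/forallP/(_ y)/andP[/implyP]. Qed.

Lemma orientation_rev E o x y :
  is_orientation E o -> E x y -> ((x, y) \in o) = ((y, x) \notin o).
Proof.
move=> /forallP/(_ x)/forallP/(_ y)/andP[_ /implyP h] /h.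
by case: (_ \in o); case: (_ \in o).
Qed.

Lemma orientation_eq E o1 o2 : is_orientation E o1 -> is_orientation E o2 ->
  (forall x y, E x y -> ((x, y) \in o1) = ((x, y) \in o2)) -> o1 = o2.
Proof.
move=> h1 h2 h; apply/setP => -[x y].
case: (boolP (E x y)) => [/h //|nE].
by apply/idP/idP => [/(orientation_sub h1)|/(orientation_sub h2)] k;
   rewrite k in nE.
Qed.

Lemma path_rank E r x p :
  path (arcs (rank_orient E r)) x p -> r x <= r (last x p).
Proof.
elim: p x => //= y p IH x /andP[]; rewrite /arcs in_rank_orient => /andP[_ h] /IH; lia.
Qed.

Lemma rank_orient_acyclic E r : symmetric E -> proper_rank E r ->
  acyclic_orientation E (rank_orient E r).
Proof.
move=> symE pr; apply/andP; split.
  apply/forallP => x; apply/forallP => y; rewrite !in_rank_orient (symE y x).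
  case: (boolP (E x y)) => //= /pr h; apply/andP; split; first by apply/implyP.
  by case: ltngtP h.
apply/forallP => x; apply/forallP => y; apply/implyP.
rewrite in_rank_orient => /andP[_ h]; apply/negP => /connectP[p /path_rank le e].
rewrite -e in le; lia.
Qed.

(** The rank counts the vertices that reach [x]: along an arc this set grows, strictly because
    acyclicity keeps the head from reaching the tail. *)
Lemma acyclic_rank E o : symmetric E -> acyclic_orientation E o ->
  exists2 r, proper_rank E r & o = rank_orient E r.
Proof.
move=> symE /andP[ho /forallP ac].
pose r x := #|[pred z | connect (arcs o) z x]|.
have mono x y : (x, y) \in o -> r x < r y.
  move=> xy; apply/proper_card/properP; split.
    by apply/subsetP => z; rewrite !inE => h; apply: connect_trans h (connect1 _).
  exists y; rewrite !inE ?connect0 //.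
  by have /forallP/(_ y)/implyP := ac x; apply.
have tot x y : E x y -> ((x, y) \in o) = (r x < r y).
  move=> xy; case: (boolP (_ \in o)) => [/mono->//|h].
  have /mono : (y, x) \in o by rewrite (orientation_rev ho) // symE.
  lia.
exists r.
  move=> x y xy; have := orientation_rev ho xy.
  by rewrite tot // tot 1?symE // -leqNgt; case: ltngtP.
apply/setP => -[x y]; rewrite in_rank_orient.
case: (boolP (E x y)) => [/tot //|nE]; apply/negP => /(orientation_sub ho).
by apply/negP.
Qed.

Lemma acyclic_orientation_is E o : acyclic_orientation E o -> is_orientation E o.
Proof. by case/andP. Qed.

Lemma potential_refl E o : potential E o o (fun=> 0).
Proof. by []. Qed.

Lemma potential_trans E o1 o2 o3 f g :
  potential E o1 o2 f -> potential E o2 o3 g ->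
  potential E o1 o3 (fun x => f x + g x).
Proof. by move=> h1 h2 x y xy; have := h1 x y xy; have := h2 x y xy => /=; mem_lia. Qed.

(** Negating [f] and adding its maximum keeps the values in [nat]; a constant shift does not affect
    the equations. *)
Lemma potential_sym E o1 o2 f : potential E o1 o2 f ->
  potential E o2 o1 (fun x => \max_z f z - f x).
Proof.
move=> h x y xy; have := h x y xy.
have := leq_bigmax (F := f) x; have := leq_bigmax (F := f) y => /=; mem_lia.
Qed.

(** On an arc of [o1] the left side of the equation is [1 + f y], while the right side is at most
    [1 + f x]. *)
Lemma potential_connect_l E o1 o2 f x y : is_orientation E o1 ->
  potential E o1 o2 f -> connect (arcs o1) x y -> f y <= f x.
Proof.
move=> ho1 pot /connectP[p]; elim: p x => [|z p IH] x /=; first by move=> _ ->.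
case/andP=> xz pp /(IH _ pp); move: xz; rewrite /arcs => xz.
by have := pot _ _ (orientation_sub ho1 xz); rewrite xz; mem_lia.
Qed.

Lemma potential_connect_r E o1 o2 f x y : is_orientation E o2 ->
  potential E o1 o2 f -> connect (arcs o2) x y -> f x <= f y.
Proof.
move=> ho2 pot /connectP[p]; elim: p x => [|z p IH] x /=; first by move=> _ ->.
case/andP=> xz pp /(IH _ pp); move: xz; rewrite /arcs => xz.
by have := pot _ _ (orientation_sub ho2 xz); rewrite xz; mem_lia.
Qed.

Lemma clickK o x : click (click o x) x = o.
Proof.
by apply/setP => -[a b]; rewrite !inE /= orbC; case: (boolP (_ || _)).
Qed.

Lemma click_orientation E o x : symmetric E ->
  is_orientation E o -> is_orientation E (click o x).
Proof.
move=> symE ho; apply/forallP => a; apply/forallP => b; rewrite !inE /=.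
rewrite (orbC (b == x)); case: ifP => _; apply/andP; split; apply/implyP.
- by move/(orientation_sub ho); rewrite symE.
- by move=> /(orientation_rev ho) ->; case: (_ \in o).
- exact: orientation_sub.
- by move=> /(orientation_rev ho) ->; case: (_ \in o).
Qed.

Lemma click_potential E o x : symmetric E -> irreflexive E ->
  is_orientation E o -> is_source E o x ->
  potential E o (click o x) (fun y => y == x).
Proof.
move=> symE irrE ho /forallP src a b ab; rewrite !inE /=.
have sx y : E x y -> (x, y) \in o by move=> xy; have /implyP := src y; apply.
case: (altP (a =P x)) => [ax|nax] /=.
  subst a; rewrite sx //; case: eqP => [bx|_]; first by rewrite bx irrE in ab.
  by move: (orientation_rev ho ab); rewrite sx // => /esym/negbTE ->.
case: eqP => [bx|//]; subst b; rewrite sx 1?symE //.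
by rewrite (orientation_rev ho ab) sx 1?symE.
Qed.

Lemma kappa_potential E o1 o2 : symmetric E -> irreflexive E ->
  is_orientation E o1 -> kappa_equiv E o1 o2 -> exists f, potential E o1 o2 f.
Proof.
move=> symE irrE ho1 k.
(* [kappa_equiv] may run clicks backwards through arbitrary sets, so the induction also carries that
   being an orientation is invariant in both directions. *)
suff [_ /(_ ho1)] : (is_orientation E o1 <-> is_orientation E o2) /\
   (is_orientation E o1 -> exists f, potential E o1 o2 f) by [].
elim: k => {o1 o2 ho1}.
- move=> o1 _ [x [src ->]]; split.
    split; first exact: click_orientation.
    by rewrite -{2}(clickK o1 x); apply: click_orientation.
  by move=> ho; exists (fun y => y == x); apply: click_potential.
- by move=> o; split=> // _; exists (fun=> 0); apply: potential_refl.
- move=> o1 o2 _ [h p]; split; first by split=> /h.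
  move=> /h /p [f /potential_sym hf]; eexists; exact: hf.
- move=> o1 o2 o3 _ [h1 p1] _ [h2 p2]; split; first by split=> [/h1/h2|/h2/h1].
  move=> ho; have [f hf] := p1 ho; have [g hg] := p2 (proj1 h1 ho).
  by exists (fun x => f x + g x); apply: potential_trans hf hg.
Qed.

(** The clicked source becomes a sink, so it can be given a rank above all others. *)
Lemma click_rank_orient E r x : symmetric E -> irreflexive E -> proper_rank E r ->
  is_source E (rank_orient E r) x ->
  exists2 r', proper_rank E r' & click (rank_orient E r) x = rank_orient E r'.
Proof.
move=> symE irrE pr /forallP src.
pose r' y := if y == x then (\max_z r z).+1 else r y.
have ub y : r y <= \max_z r z := leq_bigmax (F := r) y.
have sx y : E x y -> r x < r y.
  by move=> xy; have /implyP/(_ xy) := src y; rewrite in_rank_orient => /andP[].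
exists r'; rewrite /r'.
  move=> a b ab; have := ub a; have := ub b.
  case: (a =P x) => [ax|_]; case: (b =P x) => [bx|_]; try lia; last by rewrite pr.
  by rewrite ax bx irrE in ab.
apply/setP => -[a b]; rewrite !inE /= (symE b a).
case: (boolP (E a b)) => [ab|_] /=; last by case: ifP.
have := ub a; have := ub b.
case: (a =P x) => [ax|_]; case: (b =P x) => [bx|_] //=.
- by subst a b; rewrite irrE in ab.
- by subst a; have := sx b ab; lia.
- by subst b; have := sx a; rewrite symE => /(_ ab); lia.
Qed.

(* Every vertex of maximal potential that is first among these in [o1] is a source:
   clicking it lowers the total potential. *)
Lemma potential_kappa E o1 o2 f : symmetric E -> irreflexive E ->
  acyclic_orientation E o1 -> is_orientation E o2 ->
  potential E o1 o2 f -> kappa_equiv E o1 o2.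
Proof.
move=> symE irrE ac1 ho2.
have [n] := ubnP (\sum_x f x); elim: n o1 f ac1 => // n IH o1 f ac1 le_n pot.
have ho1 := acyclic_orientation_is ac1.
case: (boolP [forall x, f x == 0]) => [/forallP f0|].
  suff -> : o1 = o2 by apply: rst_refl.
  apply: (orientation_eq ho1 ho2) => x y /pot.
  by rewrite (eqP (f0 x)) (eqP (f0 y)); case: (_ \in o1); case: (_ \in o2).
rewrite negb_forall => /existsP[x0 fx0].
have [r pr eq_o1] := acyclic_rank symE ac1.
pose m := \max_z f z.
have ub y : f y <= m := leq_bigmax (F := f) y.
have [x1 fx1] : {x1 | m = f x1} by apply: eq_bigmax; apply/card_gt0P; exists x0.
case: (arg_minnP (P := fun x => f x == m) r (i0 := x1)); first by rewrite fx1.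
move=> x /eqP fx min_x.
(* A neighbour of smaller potential forces the arc out of [x] by the equation; one of equal
   potential has larger rank by the choice of [x]. *)
have src : is_source E o1 x.
  apply/forallP => y; apply/implyP => xy; move: (pot _ _ xy).
  rewrite eq_o1 in_rank_orient xy /=.
  have [fy|fy] := eqVneq (f y) m; last by have := ub y; mem_lia.
  by have := min_x y; rewrite fy eqxx => /(_ isT); have := pr _ _ xy; mem_lia.
have [r' pr' eq_c] : exists2 r', proper_rank E r' & click o1 x = rank_orient E r'.
  by rewrite eq_o1; apply: click_rank_orient; rewrite -?eq_o1.
apply: (rst_trans _ _ _ (click o1 x)); first by apply: rst_step; exists x.
have fx_gt0 : 0 < f x by have := ub x0; lia.
apply: (IH _ (fun y => f y - (y == x))).
- by rewrite eq_c; apply: rank_orient_acyclic.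
- rewrite ltnS in le_n; apply: leq_trans le_n.
  rewrite (bigD1 x) //= [leqRHS](bigD1 x) //= eqxx.
  suff -> : \sum_(i | i != x) (f i - (i == x)) = \sum_(i | i != x) f i by lia.
  by apply: eq_bigr => i /negbTE ->; rewrite subn0.
move=> a b ab; have := pot _ _ ab.
have := click_potential symE irrE ho1 src ab.
case: (altP (a =P x)) => [->|_]; case: (altP (b =P x)) => [->|_]; mem_lia.
Qed.

(** * Clicking whole sets of vertices *)

Lemma rank_orient_eq E r r' :
  (forall x y, E x y -> r x < r y -> r' x < r' y) -> symmetric E -> proper_rank E r ->
  rank_orient E r = rank_orient E r'.
Proof.
move=> h symE pr; apply/setP => -[x y]; rewrite !in_rank_orient.
case: (boolP (E x y)) => //= xy; have := h _ _ xy; have := h y x.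
rewrite symE => /(_ xy); have := pr _ _ xy; lia.
Qed.

(* Clicking once every vertex of a set [S] that no arc enters moves [S] to the end. *)
Lemma cut_kappa E r (S : pred V) : symmetric E -> irreflexive E -> proper_rank E r ->
  (forall x y, E x y -> ~~ S x -> S y -> r y < r x) ->
  let r' x := r x + S x * (\max_z r z).+1 in
  proper_rank E r' /\ kappa_equiv E (rank_orient E r) (rank_orient E r').
Proof.
move=> symE irrE pr cut r'.
have ub y : r y <= \max_z r z := leq_bigmax (F := r) y.
have pr' : proper_rank E r'.
  move=> x y xy; have := pr _ _ xy; have := ub x; have := ub y; rewrite /r'.
  by case: (S x); case: (S y); lia.
split=> //; apply: (potential_kappa (f := S)) => //.
- exact: rank_orient_acyclic.
- exact/acyclic_orientation_is/rank_orient_acyclic.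
move=> x y xy; rewrite !in_rank_orient xy /=.
have := ub x; have := ub y; rewrite /r'; have := pr _ _ xy.
have := cut x y xy; have := cut y x; rewrite symE => /(_ xy).
by case: (S x); case: (S y) => /=; lia.
Qed.

(** Moving all vertices ranked below [v] to the end leaves [v] minimal. *)
Lemma kappa_first E o v : symmetric E -> irreflexive E -> acyclic_orientation E o ->
  exists r, [/\ proper_rank E r, kappa_equiv E o (rank_orient E r) &
                forall x, r v <= r x].
Proof.
move=> symE irrE /(acyclic_rank symE)[r pr ->].
have [|pr' k] := @cut_kappa E r (fun x => r x < r v) symE irrE pr.
  by move=> x y _; lia.
eexists; split; [exact: pr'|exact: k|move=> x /=].
have : r v <= \max_z r z := leq_bigmax (F := r) v.
by case: (ltnP (r x) (r v)); lia.
Qed.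

(* If [v] does not reach everything, clicking the whole unreached part once reverses
   the arcs entering the reached part, which therefore grows. *)
Lemma kappa_reach_all E o v : symmetric E -> irreflexive E -> connected_graph E ->
  acyclic_orientation E o ->
  exists2 o', acyclic_orientation E o' /\ kappa_equiv E o o' &
              forall x, connect (arcs o') v x.
Proof.
move=> symE irrE conn.
have [n] := ubnP #|[pred x | ~~ connect (arcs o) v x]|.
elim: n o => // n IH o le_n ac.
case: (boolP [forall x, connect (arcs o) v x]) => [/forallP all|].
  by exists o => //; split=> //; apply: rst_refl.
rewrite negb_forall => /existsP[x0 nx0].
have [r pr eq_o] := acyclic_rank symE ac.
pose S x := ~~ connect (arcs o) v x.
have cut x y : E x y -> ~~ S x -> S y -> r y < r x.
  rewrite /S negbK => xy vx; apply: contraR; rewrite -leqNgt => le.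
  apply: connect_trans vx (connect1 _); rewrite /arcs eq_o in_rank_orient xy /=.
  by have := pr _ _ xy; lia.
have [pr' k] := cut_kappa symE irrE pr cut.
set r' := fun x => _ in pr' k; rewrite -eq_o in k.
have ub y : r y <= \max_z r z := leq_bigmax (F := r) y.
(* Reached vertices keep their ranks, hence the arcs among them survive. *)
have reach x : connect (arcs o) v x -> connect (arcs (rank_orient E r')) v x.
  case/connectP=> p; elim/last_ind: p x => [|p y IHp] x /=; first by move=> _ ->.
  rewrite rcons_path last_rcons => /andP[pp py] ->.
  apply: connect_trans (IHp _ pp erefl) (connect1 _).
  have vy : connect (arcs o) v (last v p) by apply/connectP; exists p.
  have vy' : connect (arcs o) v y := connect_trans vy (connect1 py).
  move: py; rewrite /arcs eq_o !in_rank_orient /r' /S vy vy' => /andP[-> ].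
  by rewrite /= !mul0n !addn0.
(* A path from [v] to [x0] in the connected graph leaves the reached set along some edge [ab]; after
   the clicks [b] ranks above [a], so [b] is newly reached. *)
have [a [b [ab va nb]]] : exists a b, [/\ E a b, connect (arcs o) v a &
                                        ~~ connect (arcs o) v b].
  have /connectP[p] := conn v x0; elim/last_ind: p x0 nx0 => [|p y IHp] x /=.
    by move=> nx _ ex; rewrite ex connect0 in nx.
  rewrite rcons_path last_rcons => ny /andP[pp py] exy; subst x.
  case: (boolP (connect (arcs o) v (last v p))) => h; last exact: IHp h pp erefl.
  by exists (last v p), y.
have [||o' [ac' k'] all] := IH (rank_orient E r').
- rewrite ltnS in le_n; apply: leq_trans le_n; apply/proper_card/properP; split.
    by apply/subsetP => x; rewrite !inE; apply: contra; apply: reach.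
  exists b; rewrite !inE // negbK.
  apply: connect_trans (reach _ va) (connect1 _).
  rewrite /arcs in_rank_orient ab /r' /S va nb /=; have := ub a; lia.
- exact: rank_orient_acyclic.
by exists o' => //; split=> //; apply: rst_trans k k'.
Qed.

End Potential.

(** * Permutations starting with [v, w] *)

Section StartingPermutations.
Variables (T : finType) (v w : T).
Hypothesis neq_vw : v != w.

Lemma starts_vw_index pi : starts_vw v w pi ->
  [/\ index v pi = 0, index w pi = 1,
      forall x, x != v -> x != w -> 1 < index x pi &
      forall x y, x != y -> index x pi != index y pi].
Proof.
case/andP=> perm_pi; have mem_pi x : x \in pi by rewrite (perm_mem perm_pi) mem_enum.
have inj x y : x != y -> index x pi != index y pi.
  by apply: contraNneq => eq_i; rewrite -(nth_index x (mem_pi x)) eq_i nth_index.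
case: pi {perm_pi mem_pi} inj => [|a [|b s]] inj /eqP //= [eav ebw _].
subst a b; split=> //=; rewrite ?eqxx //.
  by rewrite (negbTE neq_vw).
by move=> x nxv nxw; rewrite eq_sym (negbTE nxv) eq_sym (negbTE nxw).
Qed.

(** Only strict inequalities of [r] must be kept, so ties may be sorted arbitrarily behind
    [v, w]. *)
Lemma starts_vw_sort (r : T -> nat) : exists2 pi, starts_vw v w pi &
  forall x y, x != v -> x != w -> y != v -> y != w -> r x < r y ->
    index x pi < index y pi.
Proof.
pose leT := relpre r leq.
pose s := [seq x <- sort leT (enum T) | (x != v) && (x != w)].
have mem_s x : (x \in s) = (x != v) && (x != w).
  by rewrite mem_filter mem_sort mem_enum andbT.
have tr : transitive leT by move=> a b c; apply: leq_trans.
exists [:: v, w & s].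
  rewrite /starts_vw /= take0 eqxx andbT; apply: uniq_perm.
  - rewrite /= in_cons !mem_s eqxx (negbTE neq_vw) /= eqxx andbF /=.
    by rewrite filter_uniq // sort_uniq enum_uniq.
  - exact: enum_uniq.
  by move=> x; rewrite !in_cons mem_s mem_enum; do 2!case: eqP.
move=> x y xv xw yv yw lt_r /=.
rewrite !(eq_sym v) !(eq_sym w) (negbTE xv) (negbTE xw) (negbTE yv) (negbTE yw) !ltnS.
rewrite ltnNge; apply/negP => le_i.
have sorted_s : sorted leT s.
  by apply: sorted_filter => //; apply: sort_sorted => a b; apply: leq_total.
have : leT y x.
  apply: (sorted_leq_index tr _ sorted_s) le_i; rewrite ?mem_s ?yv ?yw ?xv //.
  by move=> a; apply: leqnn.
by rewrite /leT /=; lia.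
Qed.

(** Merging only changes the index 1 of [w] into 0; all vertices other than [v] and [w] have index
    above 1, so no comparison with them changes. *)
Lemma index_merge pi a b : starts_vw v w pi -> merge v w a != merge v w b ->
  (index (merge v w a) pi < index (merge v w b) pi) = (index a pi < index b pi).
Proof.
case/starts_vw_index=> iv iw big _; rewrite /merge.
have [->|naw] := eqVneq a w; have [->|nbw] := eqVneq b w; rewrite ?eqxx // => neq.
  by have := big b; rewrite eq_sym neq => /(_ isT nbw); lia.
by have := big a neq naw; lia.
Qed.

End StartingPermutations.

(** * Deletion and contraction of an edge *)

Section EdgeMinors.
Variables (T : finType) (E : rel T) (v w : T).
Hypotheses (symE : symmetric E) (irrE : irreflexive E) (vw : E v w).

Local Notation E1 := (del_edge E v w).
Local Notation E2 := (contr_edge E v w).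

Lemma edge_neq x y : E x y -> x != y.
Proof. by apply: contraTneq => ->; rewrite irrE. Qed.

Lemma del_edge_sym : symmetric E1.
Proof.
by move=> x y; rewrite /del_edge symE orbC !(andbC (x == _)).
Qed.

Lemma del_edge_irr : irreflexive E1.
Proof. by move=> x; rewrite /del_edge irrE. Qed.

Lemma del_edge_sub x y : E1 x y -> E x y.
Proof. by case/andP. Qed.

Lemma contr_edge_sym : symmetric E2.
Proof.
move=> x y; rewrite /contr_edge eq_sym; congr (_ && _).
by apply/existsP/existsP => -[a /existsP[b /and3P[ab ha hb]]];
  exists b; apply/existsP; exists a; rewrite symE ab ha hb.
Qed.

Lemma contr_edge_irr : irreflexive E2.
Proof. by move=> x; rewrite /contr_edge eqxx. Qed.

Lemma contr_edgeP x y : reflect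
  (exists a b, [/\ E a b, merge v w a = val x, merge v w b = val y &
                   merge v w a != merge v w b]) (E2 x y).
Proof.
apply: (iffP andP) => [[neq /existsP[a /existsP[b /and3P[ab /eqP ha /eqP hb]]]]|].
  by exists a, b; rewrite ha hb.
case=> a [b [ab ha hb neq]]; rewrite -ha -hb; split=> //.
by apply/existsP; exists a; apply/existsP; exists b; rewrite ab !eqxx.
Qed.

Lemma restrict_rank_orient r :
  restrict_del E v w (rank_orient E r) = rank_orient E1 r.
Proof.
by apply/setP => -[x y]; rewrite !inE /= /del_edge; case: (E x y) => //=; rewrite andbC.
Qed.

Lemma del_proper_rank r : proper_rank E r -> proper_rank E1 r.
Proof. by move=> pr x y /del_edge_sub /pr. Qed.

Lemma O_pi_proper pi : starts_vw v w pi -> proper_rank E (fun x => index x pi).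
Proof.
by case/(starts_vw_index (edge_neq vw)) => _ _ _ inj x y /edge_neq /inj.
Qed.

Lemma O_pi_acyclic pi : starts_vw v w pi -> acyclic_orientation E (O_pi E pi).
Proof. by move=> /O_pi_proper; apply: rank_orient_acyclic. Qed.

Lemma O_pi_contr_acyclic pi : starts_vw v w pi ->
  acyclic_orientation E2 (O_pi_contr E v w pi).
Proof.
case/(starts_vw_index (edge_neq vw)) => _ _ _ inj.
by apply: rank_orient_acyclic; [exact: contr_edge_sym | move=> x y /andP[/inj]].
Qed.

Lemma restrict_acyclic o : acyclic_orientation E o ->
  acyclic_orientation E1 (restrict_del E v w o).
Proof.
case/(acyclic_rank symE)=> r pr ->; rewrite restrict_rank_orient.
exact: rank_orient_acyclic del_edge_sym (del_proper_rank pr).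
Qed.

Lemma restrict_kappa o1 o2 : acyclic_orientation E o1 -> acyclic_orientation E o2 ->
  kappa_equiv E o1 o2 ->
  kappa_equiv E1 (restrict_del E v w o1) (restrict_del E v w o2).
Proof.
move=> ac1 ac2 k.
have [f pot] := kappa_potential symE irrE (acyclic_orientation_is ac1) k.
apply: (potential_kappa (f := f) del_edge_sym del_edge_irr).
- exact: restrict_acyclic.
- exact/acyclic_orientation_is/restrict_acyclic.
by move=> x y xy; rewrite !inE /= xy !andbT; apply/pot/del_edge_sub.
Qed.

Lemma merge_neq_w x : merge v w x != w.
Proof. by rewrite /merge; case: ifP => [_|->] //; apply: edge_neq. Qed.

(** The quotient map from the vertices of [Y] onto those of [Y'']. *)
Definition merge_sub x : {x : T | x != w} := exist _ (merge v w x) (merge_neq_w x).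

Lemma merge_eq_edge a b : E a b -> merge v w a = merge v w b ->
  (a = v /\ b = w) \/ (a = w /\ b = v).
Proof.
rewrite /merge; case: (a =P w) => [->|_]; case: (b =P w) => [->|_] ab eab; auto.
  by rewrite irrE in ab.
by rewrite eab irrE in ab.
Qed.

Lemma starts_vw_arc pi1 pi2 f : starts_vw v w pi1 -> starts_vw v w pi2 ->
  potential E (O_pi E pi1) (O_pi E pi2) f -> f v = f w.
Proof.
move=> s1 s2 /(_ _ _ vw); rewrite !in_rank_orient vw.
have [-> -> _ _] := starts_vw_index (edge_neq vw) s1.
have [-> -> _ _] := starts_vw_index (edge_neq vw) s2.
by move=> [].
Qed.

(** A potential on [Y] descends to [Y''] because [f v = f w]; one on [Y''] pulls back along
    [merge_sub], and [index_merge] matches the arcs. *)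
Lemma kappa_contr pi1 pi2 : starts_vw v w pi1 -> starts_vw v w pi2 ->
  kappa_equiv E (O_pi E pi1) (O_pi E pi2) <->
  kappa_equiv E2 (O_pi_contr E v w pi1) (O_pi_contr E v w pi2).
Proof.
move=> s1 s2; have nvw := edge_neq vw.
have ac1 := O_pi_acyclic s1; have ac2 := O_pi_acyclic s2.
have ac1' := O_pi_contr_acyclic s1; have ac2' := O_pi_contr_acyclic s2.
split=> k.
  have [f pot] := kappa_potential symE irrE (acyclic_orientation_is ac1) k.
  have fvw := starts_vw_arc s1 s2 pot.
  apply: (potential_kappa (f := fun x => f (val x)) contr_edge_sym contr_edge_irr) => //.
    exact: acyclic_orientation_is.
  move=> x y xy; rewrite !in_rank_orient xy /=.
  have /contr_edgeP[a [b [ab <- <- neq]]] := xy.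
  rewrite !index_merge //; have := pot _ _ ab; rewrite !in_rank_orient ab /=.
  have fm z : f (merge v w z) = f z by rewrite /merge; case: eqP => [->|].
  by rewrite !fm.
have [g pot] := kappa_potential contr_edge_sym contr_edge_irr
                  (acyclic_orientation_is ac1') k.
apply: (potential_kappa (f := fun x => g (merge_sub x)) symE irrE) => //.
  exact: acyclic_orientation_is.
move=> a b ab; rewrite !in_rank_orient ab /=.
have [eqm|neq] := eqVneq (merge v w a) (merge v w b).
  have -> : merge_sub a = merge_sub b by apply: val_inj.
  have [i1 i1' _ _] := starts_vw_index nvw s1.
  have [i2 i2' _ _] := starts_vw_index nvw s2.
  by case: (merge_eq_edge ab eqm) => -[-> ->]; rewrite i1 i1' i2 i2'.
have mab : E2 (merge_sub a) (merge_sub b) by apply/contr_edgeP; exists a, b.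
by have := pot _ _ mab; rewrite !in_rank_orient mab /= !index_merge.
Qed.

(** In a representative whose merged vertex has least rank, splitting that vertex into [v, w] and
    sorting the rest by rank yields a permutation inducing the same orientation. *)
Lemma contr_surj o : acyclic_orientation E2 o ->
  exists2 pi, starts_vw v w pi & kappa_equiv E2 (O_pi_contr E v w pi) o.
Proof.
move=> ac; have nvw := edge_neq vw.
have [r [pr k first]] :=
  kappa_first (merge_sub v) contr_edge_sym contr_edge_irr ac.
have [pi s hpi] := starts_vw_sort nvw (fun x => r (merge_sub x)).
exists pi => //; suff -> : O_pi_contr E v w pi = rank_orient E2 r by apply: rst_sym.
apply/esym; apply: rank_orient_eq contr_edge_sym pr => x y xy lt_r.
have [iv _ big _] := starts_vw_index nvw s.
have sub (z : {x : T | x != w}) : merge_sub (val z) = z.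
  by apply: val_inj; rewrite /= /merge (negbTE (valP z)).
have nyv : val y != v.
  apply: contraTneq lt_r => yv; rewrite -leqNgt -(sub y) yv; exact: first.
have [xv|nxv] := eqVneq (val x) v.
  by rewrite xv iv; have := big _ nyv (valP y); lia.
by apply: hpi; rewrite ?sub //; [exact: (valP x) | exact: (valP y)].
Qed.

(* If [v] is first and reaches [w] only through the edge [vw], then the proper
   ancestors of [w] other than [v] can all be clicked, after which [w] comes second. *)
Lemma no_start_connect r : proper_rank E r -> (forall x, r v <= r x) ->
  (forall pi, starts_vw v w pi -> ~ kappa_equiv E (rank_orient E r) (O_pi E pi)) ->
  connect (arcs (rank_orient E1 r)) v w.
Proof.
move=> pr first no; have nvw := edge_neq vw.
case: (boolP (connect _ _ _)) => // nc; exfalso.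
pose A x := (x != w) && connect (arcs (rank_orient E1 r)) x w.
have Av : ~~ A v by rewrite /A negb_and nc orbT.
(* An arc from [x] into [A] is not the edge [vw], as its head is neither [w] nor [v]. So [x] reaches
   [w] in [Y'], and being outside [A] it equals [w], which closes a directed cycle. *)
have cut x y : E x y -> ~~ A x -> A y -> r y < r x.
  move=> xy nAx Ay; rewrite ltnNge; apply/negP => le.
  have lt : r x < r y by have := pr _ _ xy; lia.
  have /andP[nyw yw] := Ay.
  have yx : connect (arcs (rank_orient E1 r)) x w.
    apply: connect_trans (connect1 _) yw.
    rewrite /arcs in_rank_orient lt andbT /del_edge xy (negbTE nyw) andbF /=.
    by rewrite negb_and orbC; case: eqP => //= eyv; rewrite eyv (negbTE Av) in Ay.
  case/negP: nAx; rewrite /A yx andbT; apply/eqP => exw.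
  by have /connectP[p /path_rank le' ew] := yw; rewrite -ew -exw in le'; lia.
have [pr' k] := cut_kappa symE irrE pr cut.
set r' := fun x => _ in pr' k.
have [pi s hpi] := starts_vw_sort nvw r'.
have [iv iw big _] := starts_vw_index nvw s.
apply: (no pi s); suff <- : rank_orient E r' = O_pi E pi by [].
apply: rank_orient_eq => // x y xy lt_r.
have nyv : y != v.
  apply: contraTneq lt_r => ->; have := first x.
  by rewrite /r' (negbTE Av); lia.
have [exv|nxv] := eqVneq x v.
  rewrite exv iv; have [->|nyw] := eqVneq y w; first by rewrite iw.
  by have := big y nyv nyw; lia.
have [exw|nxw] := eqVneq x w.
  by rewrite exw iw; apply: big => //; rewrite -exw eq_sym edge_neq.
have [eyw|nyw] := eqVneq y w; last exact: hpi.
(* An arc into [w] from a vertex other than [v] would start at an ancestor of [w], but all of these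
   now rank above [w]. *)
subst y; have : r w <= \max_z r z := leq_bigmax (F := r) w.
move: lt_r; rewrite /r' {2}/A eqxx /= mul0n addn0 => lt_r le.
have Ax : A x.
  rewrite /A nxw; apply: connect1; rewrite /arcs in_rank_orient.
  by rewrite /del_edge xy (negbTE nxv) (negbTE nxw) /=; lia.
by rewrite Ax in lt_r; lia.
Qed.

Lemma restrict_kappa_inj o1 o2 :
  acyclic_orientation E o1 -> acyclic_orientation E o2 ->
  (forall pi, starts_vw v w pi -> ~ kappa_equiv E o1 (O_pi E pi)) ->
  (forall pi, starts_vw v w pi -> ~ kappa_equiv E o2 (O_pi E pi)) ->
  kappa_equiv E1 (restrict_del E v w o1) (restrict_del E v w o2) ->
  kappa_equiv E o1 o2.
Proof.
move=> ac1 ac2 no1 no2 k.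
have [r1 [pr1 k1 first1]] := kappa_first v symE irrE ac1.
have [r2 [pr2 k2 first2]] := kappa_first v symE irrE ac2.
have acr1 := rank_orient_acyclic symE pr1.
have acr2 := rank_orient_acyclic symE pr2.
have c1 : connect (arcs (rank_orient E1 r1)) v w.
  apply: no_start_connect => // pi s k'; apply: (no1 pi s); exact: rst_trans k1 k'.
have c2 : connect (arcs (rank_orient E1 r2)) v w.
  apply: no_start_connect => // pi s k'; apply: (no2 pi s); exact: rst_trans k2 k'.
have kr : kappa_equiv E1 (rank_orient E1 r1) (rank_orient E1 r2).
  rewrite -!restrict_rank_orient.
  apply: rst_trans (restrict_kappa ac2 acr2 k2).
  by apply: rst_trans k; apply: rst_sym; apply: restrict_kappa.
have acr1' := rank_orient_acyclic del_edge_sym (del_proper_rank pr1).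
have acr2' := rank_orient_acyclic del_edge_sym (del_proper_rank pr2).
have ho1 := acyclic_orientation_is acr1'.
have ho2 := acyclic_orientation_is acr2'.
have [f pot] := kappa_potential del_edge_sym del_edge_irr ho1 kr.
have fvw : f v = f w.
  have := potential_connect_l ho1 pot c1.
  have := potential_connect_r ho2 pot c2; lia.
apply: rst_trans k1 (rst_trans _ _ _ _ _ _ (rst_sym _ _ _ _ k2)).
apply: (potential_kappa (f := f) symE irrE) => //.
  exact: acyclic_orientation_is.
(* Minimality of [v] directs [vw] from [v] to [w] in both orientations, so its equation reduces to
   [f v = f w]. *)
have lt1 : r1 v < r1 w by have := first1 w; have := pr1 _ _ vw; lia.
have lt2 : r2 v < r2 w by have := first2 w; have := pr2 _ _ vw; lia.
move=> x y xy; case: (boolP (E1 x y)) => [xy1|].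
  by have := pot _ _ xy1; rewrite !in_rank_orient xy xy1.
rewrite /del_edge xy negbK !in_rank_orient xy /=.
by case/orP=> /andP[/eqP-> /eqP->]; rewrite fvw; lia.
Qed.

Lemma del_surj o : connected_graph E1 -> acyclic_orientation E1 o ->
  exists2 o', acyclic_orientation E o' /\
              (forall pi, starts_vw v w pi -> ~ kappa_equiv E o' (O_pi E pi)) &
              kappa_equiv E1 (restrict_del E v w o') o.
Proof.
move=> conn ac; have nvw := edge_neq vw.
have [o1 [ac1 k] reach] := kappa_reach_all v del_edge_sym del_edge_irr conn ac.
have [r pr eq_o1] := acyclic_rank del_edge_sym ac1; subst o1.
(* [x] is the last vertex before [w] on a path in [Y']; it differs from [v] since [vw] is
   deleted. *)
have [x [vx xw]] : exists x, connect (arcs (rank_orient E1 r)) v x /\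
                            arcs (rank_orient E1 r) x w.
  have /connectP[p] := reach w; case/lastP: p => [_ ewv|p y].
    by rewrite ewv eqxx in nvw.
  rewrite rcons_path last_rcons => /andP[pp py] ey; subst y.
  by exists (last v p); split=> //; apply/connectP; exists p.
have /andP[xw1 ltxw] : E1 x w && (r x < r w) by rewrite -in_rank_orient.
have ltvw : r v < r w.
  by have /connectP[p /path_rank le ex] := vx; rewrite -ex in le; lia.
have pr' : proper_rank E r.
  move=> a b ab; case: (boolP (E1 a b)) => [/pr //|].
  by rewrite /del_edge ab negbK => /orP[] /andP[/eqP-> /eqP->]; lia.
have ac' := rank_orient_acyclic symE pr'.
exists (rank_orient E r); last by rewrite restrict_rank_orient; apply: rst_sym.
split=> // pi s k'.
(* The edge [vw] gives [f v = f w], and reachability gives [f x <= f v]; but [w] precedes [x] in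
   [pi], so the reversed arc from [x] to [w] forces [f x = f w + 1]. *)
have [f pot] := kappa_potential symE irrE (acyclic_orientation_is ac') k'.
have [iv iw big _] := starts_vw_index nvw s.
have := pot _ _ vw; rewrite !in_rank_orient vw ltvw iv iw /= => fvw.
have vx' : connect (arcs (rank_orient E r)) v x.
  apply: connect_sub vx => a b; rewrite /arcs in_rank_orient => /andP[ab lt].
  by apply: connect1; rewrite in_rank_orient lt (del_edge_sub ab).
have := potential_connect_l (acyclic_orientation_is ac') pot vx'.
have := pot _ _ (del_edge_sub xw1).
rewrite !in_rank_orient (del_edge_sub xw1) ltxw iw /=.
have nxv : x != v.
  by apply: contraTneq xw1 => ->; rewrite /del_edge !eqxx andbF.
have := big x nxv (edge_neq (del_edge_sub xw1)); lia.
Qed.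

(** Hides the choice operator: the chosen [pi] is known only through its two properties. *)
Lemma Theta_cases o :
  (exists pi, [/\ starts_vw v w pi, kappa_equiv E o (O_pi E pi) &
                  Theta E v w o = inr (O_pi_contr E v w pi)]) \/
  ((forall pi, starts_vw v w pi -> ~ kappa_equiv E o (O_pi E pi)) /\
   Theta E v w o = inl (restrict_del E v w o)).
Proof.
rewrite /Theta; case: excluded_middle_informative => [H|no].
  left; case: constructive_indefinite_description => pi [s k] /=.
  by exists pi.
by right; split=> // pi s k; apply: no; exists pi.
Qed.

End EdgeMinors.

(* Theta is well defined on kappa-classes and the induced map
   Acyc(Y)/~k -> Acyc(Y')/~k + Acyc(Y'')/~k is a bijection. *)
Theorem theorem2 (T : finType) (E : rel T) (v w : T) :
  simple_graph E -> connected_graph E -> cycle_edge E v w ->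
  (* well defined *)
  (forall O1 O2, acyclic_orientation E O1 -> acyclic_orientation E O2 ->
     kappa_equiv E O1 O2 -> kappa_sum E v w (Theta E v w O1) (Theta E v w O2)) /\
  (* lands in Acyc(Y') + Acyc(Y'') *)
  (forall O, acyclic_orientation E O -> acyc_sum E v w (Theta E v w O)) /\
  (* injective on classes *)
  (forall O1 O2, acyclic_orientation E O1 -> acyclic_orientation E O2 ->
     kappa_sum E v w (Theta E v w O1) (Theta E v w O2) -> kappa_equiv E O1 O2) /\
  (* surjective on classes *)
  (forall X, acyc_sum E v w X ->
     exists O, acyclic_orientation E O /\ kappa_sum E v w (Theta E v w O) X).
Proof.
move=> [symE irrE] conn [vw cyc].
have well O1 O2 : acyclic_orientation E O1 -> acyclic_orientation E O2 ->
     kappa_equiv E O1 O2 -> kappa_sum E v w (Theta E v w O1) (Theta E v w O2).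
  move=> ac1 ac2 k.
  case: (Theta_cases E v w O1) => [[p1 [s1 k1 ->]]|[no1 ->]];
  case: (Theta_cases E v w O2) => [[p2 [s2 k2 ->]]|[no2 ->]] /=.
  - apply/(kappa_contr symE irrE vw s1 s2).
    exact: rst_trans (rst_sym _ _ _ _ k1) (rst_trans _ _ _ _ _ k k2).
  - by case: (no2 _ s1); apply: rst_trans (rst_sym _ _ _ _ k) k1.
  - by case: (no1 _ s2); apply: rst_trans k k2.
  - exact: restrict_kappa.
split; first exact: well.
split; [|split].
- move=> O ac.
  case: (Theta_cases E v w O) => [[p [s k ->]]|[no ->]] /=.
    exact: O_pi_contr_acyclic.
  exact: restrict_acyclic.
- move=> O1 O2 ac1 ac2.
  case: (Theta_cases E v w O1) => [[p1 [s1 k1 ->]]|[no1 ->]];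
  case: (Theta_cases E v w O2) => [[p2 [s2 k2 ->]]|[no2 ->]] //=.
    move=> /(kappa_contr symE irrE vw s1 s2) k.
    exact: rst_trans k1 (rst_trans _ _ _ _ _ k (rst_sym _ _ _ _ k2)).
  exact: restrict_kappa_inj.
move=> [a|a] /= ac.
  (* The cycle-edge hypothesis makes [Y'] connected. *)
  have conn1 : connected_graph (del_edge E v w) by move=> x y; apply/cyc/conn.
  have [O [acO no] k] := del_surj symE irrE vw conn1 ac.
  exists O; split=> //.
  by case: (Theta_cases E v w O) => [[p [s k' _]]|[_ ->]] //=; case: (no _ s).
have [pi s k] := contr_surj symE irrE vw ac.
have acO := O_pi_acyclic symE irrE vw s.
exists (O_pi E pi); split=> //.
(* [Theta] may choose another permutation than [pi]; [kappa_contr] identifies the two induced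
   classes. *)
case: (Theta_cases E v w (O_pi E pi)) => [[p [s' k' ->]]|[no _]] /=.
  apply: rst_trans k; apply: rst_sym.
  exact/(kappa_contr symE irrE vw s s').
by case: (no _ s); apply: rst_refl.
Qed.
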